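(* Let $(\mathfrak{a},\ell_0,\ell_1,\dots,\ell_n)$ be a curved $L_n$ algebra. If $\mathfrak{a}$ has a Maurer--Cartan element, then the cohomology class $N$ of $p(\ell_0)$ in $H(\mathfrak{a}_{\mathrm{ab}},d)$ is zero.
   Context: A curved $L_\infty$ algebra is a graded vector space $\mathfrak{a}$ (over a field of characteristic $0$, e.g. $\mathbb{R}$) with graded-antisymmetric maps $\ell_k:\mathfrak{a}^{\otimes k}\to\mathfrak{a}$ of degree $2-k$, $k=0,1,2,\dots$ ($\ell_0$ being an element of degree $2$); graded antisymmetry means that swapping two adjacent homogeneous arguments $v,w$ multiplies the value by $-(-1)^{|v||w|}$. They satisfy, for all $n\ge0$ and homogeneous $v_1,\dots,v_n$, the higher Jacobi identity $$\sum_{i+j=n+1}\ \sum_{\sigma\in\mathrm{UnShuff}(i,j-1)}\chi(\sigma;v_1,\dots,v_n)(-1)^{i(n-i)}\ell_j(\ell_i(v_{\sigma(1)},\dots,v_{\sigma(i)}),v_{\sigma(i+1)},\dots,v_{\sigma(n)})=0,$$ with $i\ge0$, $j\ge1$, where $\mathrm{UnShuff}(i,j-1)$ is the set of permutations with $\sigma(1)<\dots<\sigma(i)$ and $\sigma(i+1)<\dots<\sigma(n)$, and $\chi$ is the antisymmetric Koszul sign (a factor $-(-1)^{|v||w|}$ for each swap of adjacent $v,w$). A curved $L_n$ algebra is a curved $L_\infty$ algebra with $\ell_k=0$ for $k>n$. A Maurer--Cartan element is a degree $1$ element $\omega$ with $0=\sum_{k=0}^n\varsigma(k)\frac{1}{k!}\ell_k(\omega,\dots,\omega)=-\ell_0+\ell_1(\omega)+\frac12\ell_2(\omega,\omega)-\frac1{3!}\ell_3(\omega,\omega,\omega)-\cdots$,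 where $\varsigma(k)=-(-1)^{k(k+1)/2}$. Let $\mathfrak{a}'$ be the linear span of the images of $\ell_2,\dots,\ell_n$, let $\mathfrak{a}_{\mathrm{ab}}=\mathfrak{a}/\mathfrak{a}'$ and $p:\mathfrak{a}\to\mathfrak{a}_{\mathrm{ab}}$ the projection. The bracket $\ell_1$ descends to an operator $d$ on $\mathfrak{a}_{\mathrm{ab}}$ with $d^2=0$ and $d(p(\ell_0))=0$; $H(\mathfrak{a}_{\mathrm{ab}},d)$ is the cohomology of this complex. *)

(* Defs.v *)
From HB Require Import structures.
From mathcomp Require Import all_boot all_order all_algebra all_fingroup.
From mathcomp Require Import generic_quotient ring_quotient.
From mathcomp Require Import boolp.

Set Implicit Arguments.
Unset Strict Implicit.
Unset Printing Implicit Defensive.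

Import GRing.Theory.
Local Open Scope ring_scope.
Local Open Scope quotient_scope.

Definition submod_pred (R : pzRingType) (V : lmodType R) (I : submodClosed V) :
  {pred V} := fun x => x \in I.

Lemma submod_pred_closed (R : pzRingType) (V : lmodType R) (I : submodClosed V) :
  zmod_closed (submod_pred I).
Proof. exact: GRing.submod_closedB (submodClosedP I). Qed.

HB.instance Definition _ (R : pzRingType) (V : lmodType R) (I : submodClosed V) :=
  GRing.isZmodClosed.Build V (submod_pred I) (submod_pred_closed I).

(* The quotient of ring_quotient is only a zmodType; we add the scaling. *)
Definition lmod_quot (R : pzRingType) (V : lmodType R) (I : submodClosed V) :=
  Quotient.quot (submod_pred I).

Section LmodQuotient.
Variables (R : pzRingType) (V : lmodType R) (I : submodClosed V).

HB.instance Definition _ := GRing.Zmodule.on (lmod_quot I).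

Definition quot_proj (x : V) : lmod_quot I := \pi_(Quotient.quot (submod_pred I)) x.
Definition quot_repr (q : lmod_quot I) : V := repr (q : Quotient.quot (submod_pred I)).

Lemma quot_reprK q : quot_proj (quot_repr q) = q.
Proof. exact: reprK. Qed.

Lemma quot_projP x y : reflect (quot_proj x = quot_proj y) (x - y \in I).
Proof.
by rewrite -[_ \in I]/(_ \in submod_pred I) Quotient.idealrBE; apply: eqP.
Qed.

Lemma quot_projD x y : quot_proj (x + y) = quot_proj x + quot_proj y.
Proof. exact: (raddfD (\pi_(Quotient.quot (submod_pred I)))). Qed.

Definition quot_scale (a : R) (q : lmod_quot I) := quot_proj (a *: quot_repr q).

Lemma quot_scaleE a x : quot_scale a (quot_proj x) = quot_proj (a *: x).
Proof.
apply/quot_projP; rewrite -scalerBr rpredZ //.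
by apply/quot_projP; rewrite quot_reprK.
Qed.

Lemma quot_scaleA a b q : quot_scale a (quot_scale b q) = quot_scale (a * b) q.
Proof. by rewrite -[q]quot_reprK !quot_scaleE scalerA. Qed.

Lemma quot_scale1 : left_id 1 quot_scale.
Proof. by move=> q; rewrite -[q]quot_reprK quot_scaleE scale1r. Qed.

Lemma quot_scaleDr : right_distributive quot_scale +%R.
Proof.
move=> a q r; rewrite -[q]quot_reprK -[r]quot_reprK -quot_projD.
by rewrite !quot_scaleE scalerDr quot_projD.
Qed.

Lemma quot_scaleDl q : {morph quot_scale^~ q : a b / a + b}.
Proof.
by move=> a b; rewrite -[q]quot_reprK !quot_scaleE scalerDl quot_projD.
Qed.

HB.instance Definition _ := GRing.Zmodule_isLmodule.Build R (lmod_quot I)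
  quot_scaleA quot_scale1 quot_scaleDr quot_scaleDl.

Lemma quot_proj_is_linear : linear quot_proj.
Proof. by move=> a x y; rewrite quot_projD -quot_scaleE. Qed.

HB.instance Definition _ :=
  GRing.isLinear.Build R V (lmod_quot I) _ quot_proj quot_proj_is_linear.

End LmodQuotient.

Arguments quot_proj {R V} I x.

Record complex (K : fieldType) := Complex {
  cx_sort :> lmodType K;
  cx_d : {linear cx_sort -> cx_sort};
  cx_dd : forall x, cx_d (cx_d x) = 0 }.

Section Cohomology.
Variables (K : fieldType) (C : complex K).

Definition cocycle_pred : {pred C} := fun x => cx_d C x == 0.

Lemma cocycle_submod_closed : submod_closed cocycle_pred.
Proof.
split=> [|a x y]; rewrite !unfold_in ?linear0 // => /eqP x0 /eqP y0.
by rewrite linearP x0 y0 scaler0 addr0.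
Qed.

HB.instance Definition _ :=
  GRing.isSubmodClosed.Build K C cocycle_pred
    (GRing.submod_closed_semi cocycle_submod_closed).

Record cocycle := Cocycle { cocycle_val :> C; _ : cocycle_val \in cocycle_pred }.

HB.instance Definition _ := [isSub for cocycle_val].
HB.instance Definition _ := [Choice of cocycle by <:].
HB.instance Definition _ := [SubChoice_isSubLmodule of cocycle by <:].

Definition coboundary_pred : {pred cocycle} :=
  fun z => `[< exists y : C, cocycle_val z = cx_d C y >].

Lemma coboundary_submod_closed : submod_closed coboundary_pred.
Proof.
split=> [|a z1 z2].
  by apply/asboolP; exists 0; rewrite linear0; apply: (linear0 (\val : cocycle -> C)).
move=> /asboolP[y1 e1] /asboolP[y2 e2]; apply/asboolP.
exists (a *: y1 + y2); rewrite linearP -e1 -e2.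
exact: (linearP (\val : cocycle -> C)).
Qed.

HB.instance Definition _ :=
  GRing.isSubmodClosed.Build K cocycle coboundary_pred
    (GRing.submod_closed_semi coboundary_submod_closed).

(* ker d / im d, all degrees together *)
Definition cohomology := lmod_quot coboundary_pred.

HB.instance Definition _ := GRing.Lmodule.on cohomology.

Lemma cocycle_predP (x : C) : cx_d C x = 0 -> x \in cocycle_pred.
Proof. by move=> dx0; rewrite unfold_in dx0. Qed.

Definition cohomology_class (x : C) (dx0 : cx_d C x = 0) : cohomology :=
  quot_proj coboundary_pred (Cocycle (cocycle_predP dx0)).

End Cohomology.

(* A graded vector space is a K-module that is the internal direct sum of the
   submodules [homog i], i : int; no finiteness is assumed. *)
Record grading (K : fieldType) (A : lmodType K) := Grading {
  homog : int -> A -> Prop;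
  homog0 : forall i, homog i 0;
  homogP : forall i (a : K) x y, homog i x -> homog i y -> homog i (a *: x + y);
  homog_span : forall x, exists (s : seq int) (f : int -> A),
    (forall i, homog i (f i)) /\ x = \sum_(i <- s) f i;
  homog_direct : forall (s : seq int) (f : int -> A),
    uniq s -> (forall i, homog i (f i)) -> \sum_(i <- s) f i = 0 ->
    forall i, i \in s -> f i = 0 }.

(* The antisymmetric Koszul sign of s : 'S_n for arguments of degrees d,
   as a product over the inversions of s; [koszul_sign1] and
   [koszul_sign_swap] show that it is the sign obtained by picking up a factor
   -(-1)^(|v||w|) for each swap of adjacent v, w. *)
Definition swap_sign (K : fieldType) (p q : int) : K := - (-1) ^ (p * q).

Definition koszul_sign (K : fieldType) (n : nat) (d : 'I_n -> int) (s : 'S_n) : K :=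
  \prod_(i < n) \prod_(j < n | (i < j)%N && (s j < s i)%N)
    swap_sign K (d (s i)) (d (s j)).

(* s(0) < ... < s(i-1) and s(i) < ... < s(n-1) *)
Definition is_unshuffle (n i : nat) (s : 'S_n) : bool :=
  [forall a : 'I_n, forall b : 'I_n,
    (a < b)%N && ((b < i)%N || (i <= a)%N) ==> (s a < s b)%N].

Section KoszulSign.
Variables (K : fieldType) (n : nat) (d : 'I_n -> int).

Lemma koszul_sign1 : koszul_sign K d 1 = 1.
Proof.
apply: big1 => i _; apply: big1 => j /andP[ij].
by rewrite !permE ltnNge ltnW.
Qed.

Lemma swap_signC p q : swap_sign K p q = swap_sign K q p.
Proof. by rewrite /swap_sign mulrC. Qed.

Lemma swap_signK p q : swap_sign K p q * swap_sign K p q = 1.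
Proof.
by rewrite /swap_sign mulrNN -exprzMl ?unitrN1 ?unitr1 // mulrNN mulr1 exp1rz.
Qed.

Lemma koszul_sign_swap (s : 'S_n) (k l : 'I_n) : l = k.+1 :> nat ->
  koszul_sign K d (tperm k l * s)%g =
    swap_sign K (d (s k)) (d (s l)) * koszul_sign K d s.
Proof.
move=> lk.
pose G (t : 'S_n) (p : 'I_n * 'I_n) : K :=
  if (t p.2 < t p.1)%N then swap_sign K (d (t p.1)) (d (t p.2)) else 1.
have kE t : koszul_sign K d t = \prod_(p : 'I_n * 'I_n | (p.1 < p.2)%N) G t p.
  rewrite /koszul_sign.
  transitivity (\prod_(i < n) \prod_(j < n | (i < j)%N) G t (i, j)).
    by apply: eq_bigr => i _; rewrite big_mkcondr.
  by rewrite pair_big_dep.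
have kl : (k < l)%N by rewrite lk.
have nkl : k != l by rewrite -val_eqE /= ltn_eqF.
set u := (tperm k l * s)%g.
have uE x : u x = s (tperm k l x) by rewrite permM.
rewrite !kE (bigD1 (k, l)) //= [in RHS](bigD1 (k, l)) //= mulrA; congr (_ * _).
  rewrite /G /= !uE tpermL tpermR.
  case: (ltngtP (s k) (s l)) => [||/val_inj/perm_inj e]; last by rewrite e eqxx in nkl.
    by rewrite mulr1 swap_signC.
  by rewrite swap_signK.
pose h (p : 'I_n * 'I_n) := (tperm k l p.1, tperm k l p.2).
have hK : involutive h by move=> [a b]; rewrite /h /= !tpermK.
rewrite (reindex_inj (inv_inj hK)) /=; apply: eq_big => [[a b]|[a b] _]; last first.
  by rewrite /G /= !uE !tpermK.
rewrite /h /= !xpair_eqE.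
have tk (x : 'I_n) : (tperm k l x == k) = (x == l).
  by rewrite -[X in _ == X](tpermR k l) (inj_eq perm_inj).
have tl (x : 'I_n) : (tperm k l x == l) = (x == k).
  by rewrite -[X in _ == X](tpermL k l) (inj_eq perm_inj).
rewrite tk tl.
case: (tpermP k l a) => [->|->|/eqP ak /eqP al];
  case: (tpermP k l b) => [->|->|/eqP bk /eqP bl];
  rewrite ?eqxx ?ltnn ?(eq_sym l k) ?(negbTE nkl) ?(negbTE ak) ?(negbTE al)
    ?(negbTE bk) ?(negbTE bl) ?andbF ?andbT ?lk ?ltnn ?ltnSn //=.
- by rewrite ltnNge leqnSn.
- by rewrite [LHS]ltn_neqAle -lk (inj_eq (@ord_inj n)) (eq_sym l) bl.
- by rewrite ltnNge leqnSn.
- by rewrite [RHS]ltn_neqAle -lk (inj_eq (@ord_inj n)) (eq_sym l) bl.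
- by rewrite ltnS [in LHS]leq_eqVlt (inj_eq (@ord_inj n)) (negbTE ak).
- by rewrite ltnS [in RHS]leq_eqVlt (inj_eq (@ord_inj n)) (negbTE ak).
Qed.

End KoszulSign.

(* The family of brackets l_k : A^k -> A, k >= 0, is encoded as one function
   [ell] on finite sequences: l_k is the restriction of [ell] to the sequences
   of size k; in particular l_0 = ell [::]. *)
Record curvedLinfty (K : fieldType) := CurvedLinfty {
  Linfty_sort :> lmodType K;
  Linfty_grading : grading Linfty_sort;
  ell : seq Linfty_sort -> Linfty_sort;
  ell_multilinear : forall (s t : seq Linfty_sort) (a : K) (x y : Linfty_sort),
    ell (s ++ (a *: x + y) :: t) = a *: ell (s ++ x :: t) + ell (s ++ y :: t);
  ell_degree : forall (n : nat) (v : 'I_n -> Linfty_sort) (d : 'I_n -> int),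
    (forall k, homog Linfty_grading (d k) (v k)) ->
    homog Linfty_grading (\sum_(k < n) d k + (2 - n%:Z)) (ell [seq v k | k : 'I_n]);
  ell_antisym : forall (s t : seq Linfty_sort) (p q : int) (x y : Linfty_sort),
    homog Linfty_grading p x -> homog Linfty_grading q y ->
    ell (s ++ x :: y :: t) = swap_sign K p q *: ell (s ++ y :: x :: t);
  ell_jacobi : forall (n : nat) (v : 'I_n -> Linfty_sort) (d : 'I_n -> int),
    (forall k, homog Linfty_grading (d k) (v k)) ->
    \sum_(i < n.+1) \sum_(s : 'S_n | is_unshuffle i s)
      (let w := [seq v (s k) | k : 'I_n] in
       (koszul_sign K d s * (-1) ^+ (i * (n - i))) *:
         ell (ell (take i w) :: drop i w)) = 0 }.

Arguments ell {K c} s.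

Record curvedLn (K : fieldType) (n : nat) := CurvedLn {
  Ln_Linfty :> curvedLinfty K;
  ell_vanish : forall s : seq Ln_Linfty, (n < size s)%N -> ell s = 0 }.

Section CurvedLn.
Variables (K : fieldType) (n : nat) (L : curvedLn K n).

(* varsigma k = -(-1)^(k(k+1)/2); the product k(k+1) is even *)
Definition varsigma (k : nat) : K := - (-1) ^+ (k * k.+1)./2.

Definition maurer_cartan (w : L) : Prop :=
  homog (Linfty_grading L) 1 w /\
  \sum_(k < n.+1) (varsigma k * (k`!%:R)^-1) *: ell (nseq k w) = 0.

(* a', the linear span of the images of l_2, ..., l_n *)
Definition derived_pred : {pred L} := fun x =>
  `[< exists (m : nat) (c : 'I_m -> K) (s : 'I_m -> seq L),
        (forall i, 2 <= size (s i) <= n)%N /\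
        x = \sum_(i < m) c i *: ell (s i) >].

Lemma derived_submod_closed : submod_closed derived_pred.
Proof.
split=> [|a x y /asboolP[m1 [c1 [s1 [h1 ->]]]] /asboolP[m2 [c2 [s2 [h2 ->]]]]].
  apply/asboolP; exists 0%N, (fun=> 0), (fun=> [::]).
  by split=> [[]//|]; rewrite big_ord0.
apply/asboolP; exists (m1 + m2)%N.
exists (fun i => match split i with inl j => a * c1 j | inr j => c2 j end).
exists (fun i => match split i with inl j => s1 j | inr j => s2 j end).
split=> [i|]; first by case: (split i) => j.
rewrite big_split_ord scaler_sumr /=; congr (_ + _); apply: eq_bigr => i _.
  by rewrite -[lshift _ _]/(unsplit (inl i)) unsplitK scalerA.
by rewrite -[rshift _ _]/(unsplit (inr i)) unsplitK.
Qed.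

HB.instance Definition _ :=
  GRing.isSubmodClosed.Build K L derived_pred
    (GRing.submod_closed_semi derived_submod_closed).

Definition abelianization := lmod_quot derived_pred.

HB.instance Definition _ := GRing.Lmodule.on abelianization.

Definition ab_proj (x : L) : abelianization := quot_proj derived_pred x.

HB.instance Definition _ := GRing.Linear.copy ab_proj (quot_proj derived_pred).

Definition ell1 (x : L) : L := ell [:: x].

Lemma ell1_is_linear : linear ell1.
Proof. by move=> a x y; apply: (ell_multilinear [::] [::]). Qed.

HB.instance Definition _ := GRing.isLinear.Build K L L _ ell1 ell1_is_linear.

Lemma ell_derived (s : seq L) : (2 <= size s)%N -> ell s \in derived_pred.
Proof.
move=> s2; have [sn|/ell_vanish ->] := leqP (size s) n; last exact: rpred0.
apply/asboolP; exists 1%N, (fun=> 1), (fun=> s); split=> [i|]; first by rewrite s2.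
by rewrite big_ord1 scale1r.
Qed.

Lemma ell_slot_sum (s t : seq L) (r : seq int) (f : int -> L) :
  ell (s ++ (\sum_(i <- r) f i) :: t) = \sum_(i <- r) ell (s ++ f i :: t).
Proof.
have e0 : ell (s ++ 0 :: t) = 0.
  have := ell_multilinear s t (-1) 0 0.
  by rewrite scaler0 addr0 scaleN1r addNr.
elim: r => [|i r IH]; first by rewrite !big_nil.
by rewrite !big_cons -IH -{1}[f i]scale1r ell_multilinear scale1r.
Qed.

(* A property of sequences that is additive in each slot holds as soon as it
   holds for homogeneous arguments. *)
Lemma homog_ind (P : seq L -> Prop) :
  (forall s t (r : seq int) (f : int -> L), (forall i, P (s ++ f i :: t)) ->
     P (s ++ (\sum_(i <- r) f i) :: t)) ->
  (forall m (v : 'I_m -> L) (d : 'I_m -> int),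
     (forall k, homog (Linfty_grading L) (d k) (v k)) ->
     P [seq v k | k : 'I_m]) ->
  forall s, P s.
Proof.
move=> Psum Phom s.
suff gen t u : (forall k, (k < size t)%N ->
    exists i, homog (Linfty_grading L) i (nth 0 t k)) -> P (t ++ u).
  by apply: (gen [::]).
elim: u t => [|x u IH] t ht.
  rewrite cats0.
  have [d hd] : exists d : 'I_(size t) -> int,
      forall k, homog (Linfty_grading L) (d k) (nth 0 t k).
    have /choice[d hd] (k : 'I_(size t)) := ht k (ltn_ord k).
    by exists d.
  rewrite (_ : t = [seq nth 0 t k | k : 'I_(size t)]); first exact: Phom hd.
  by rewrite -[LHS](mkseq_nth 0) /mkseq -val_enum_ord -map_comp.
have [r [f [hf ->]]] := homog_span (Linfty_grading L) x.
apply: Psum => i; rewrite -cat_rcons; apply: IH => k.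
rewrite size_rcons ltnS leq_eqVlt nth_rcons => /orP[/eqP->|kt].
  by rewrite ltnn eqxx; exists i.
by rewrite kt; apply: ht.
Qed.

Lemma ell1_ell0 : ell1 (ell [::]) = 0.
Proof.
have v0 : 'I_0 -> L by case.
have d0 : 'I_0 -> int by case.
have := @ell_jacobi _ L 0 v0 d0; rewrite big_ord1 /=.
rewrite (bigD1 1%g) /=; last by apply/forallP => -[].
rewrite [X in _ + X]big1 => [|s /andP[_]]; last first.
  by rewrite (_ : s = 1%g) ?eqxx //; apply/permP => -[].
have -> : [seq v0 ((1%g : 'S_0) k) | k : 'I_0] = [::].
  by apply: size0nil; rewrite size_map size_enum_ord.
by rewrite koszul_sign1 mul1r mul0n expr0 scale1r addr0; apply; case.
Qed.

(* The terms with j >= 2 of the Jacobi identity lie in the derived submodule. *)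
Lemma ell1_ell (s : seq L) : (0 < size s)%N -> ell1 (ell s) \in derived_pred.
Proof.
move: s; apply: homog_ind => [s t r f IH sz|m v d hd sz].
  rewrite ell_slot_sum linear_sum; apply: rpred_sum => i _; apply: IH.
  by move: sz; rewrite !size_cat.
have := ell_jacobi hd; rewrite big_ord_recr /= => /eqP.
rewrite addrC addr_eq0 (bigD1 1%g) /=; last first.
  apply/forallP => a; apply/forallP => b; apply/implyP => /andP[ab _].
  by rewrite !permE.
have sE (s : 'S_m) : size [seq v (s k) | k : 'I_m] = m.
  by rewrite size_map size_enum_ord.
rewrite [X in _ + X]big1 => [|s /andP[/forallP us /eqP[]]]; last first.
  have lt_s (a b : 'I_m) : (a < b)%N -> (s a < s b)%N.
    by move=> ab; have /forallP/(_ b)/implyP := us a; apply; rewrite ab ltn_ord.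
  have le_s k : forall a : 'I_m, val a = k -> (k <= s a)%N.
    elim: k => // k IH a ak.
    have km : (k < m)%N by rewrite ltnW // -ak ltn_ord.
    apply: leq_ltn_trans (IH (Ordinal km) erefl) _.
    by apply: lt_s; rewrite /= ak.
  have ge_s k : forall a : 'I_m, (m - a.+1)%N = k -> (s a <= a)%N.
    elim: k => [|k IH] a ak.
      have am : m = a.+1.
        by apply/eqP; rewrite eqn_leq ltn_ord -subn_eq0 ak eqxx.
      by rewrite -ltnS -am ltn_ord.
    have am : (a.+1 < m)%N by rewrite -subn_gt0 ak.
    rewrite -ltnS.
    apply: leq_trans (lt_s a (Ordinal am) (ltnSn _)) (IH (Ordinal am) _).
    by rewrite /= subnS ak.
  apply/permP => a; rewrite perm1; apply/val_inj/eqP => /=.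
  by rewrite eqn_leq (le_s _ _ erefl) (ge_s _ _ erefl).
have wE : [seq v ((1%g : 'S_m) k) | k : 'I_m] = [seq v k | k : 'I_m].
  by apply: eq_map => k; rewrite perm1.
rewrite koszul_sign1 mul1r subnn muln0 expr0 scale1r addr0 wE.
have sv : size [seq v k | k : 'I_m] = m by rewrite size_map size_enum_ord.
rewrite take_oversize ?sv // drop_oversize ?sv // => /eqP.
rewrite -[ell [:: _]]/(ell1 _) => ->.
rewrite rpredN; apply: rpred_sum => i _; apply: rpred_sum => s _.
apply/rpredZ/ell_derived => /=.
by rewrite size_drop sE ltnS subn_gt0.
Qed.

Lemma ell1_derived (x : L) : x \in derived_pred -> ell1 x \in derived_pred.
Proof.
move=> /asboolP[m [c [s [hs ->]]]]; rewrite linear_sum; apply: rpred_sum => i _.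
rewrite linearZ; apply/rpredZ/ell1_ell.
by case/andP: (hs i) => s2 _; apply: ltnW.
Qed.

Definition ab_d (q : abelianization) : abelianization :=
  ab_proj (ell1 (quot_repr q)).

Lemma ab_dE (x : L) : ab_d (ab_proj x) = ab_proj (ell1 x).
Proof.
apply/quot_projP; rewrite -linearB; apply: ell1_derived.
by apply/quot_projP; rewrite quot_reprK.
Qed.

Lemma ab_d_is_linear : linear ab_d.
Proof.
move=> a q r; rewrite -[q]quot_reprK -[r]quot_reprK -!/(ab_proj _).
by rewrite -linearP !ab_dE !linearP.
Qed.

HB.instance Definition _ :=
  GRing.isLinear.Build K abelianization abelianization _ ab_d ab_d_is_linear.

Lemma ab_dd (q : abelianization) : ab_d (ab_d q) = 0.
Proof.
rewrite -[q]quot_reprK -/(ab_proj _) !ab_dE -[0](linear0 ab_proj).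
by apply/quot_projP; rewrite subr0 ell1_ell.
Qed.

Definition ab_complex : complex K := Complex ab_dd.

Lemma ab_d_curvature : ab_d (ab_proj (ell [::])) = 0.
Proof. by rewrite ab_dE ell1_ell0 linear0. Qed.

Definition curvature_class : cohomology ab_complex :=
  @cohomology_class K ab_complex (ab_proj (ell [::])) ab_d_curvature.

End CurvedLn.

Arguments maurer_cartan {K n L} w.

(* Main.v *)
Require Import Defs.
From mathcomp Require Import all_boot all_order all_algebra.
From mathcomp Require Import boolp.
Import GRing.Theory.
Local Open Scope ring_scope.

(** Every bracket of two or more arguments dies in the abelianization, so projecting the
    Maurer-Cartan equation of [w] leaves only its terms k = 0 and k = 1. These say that the
    projected curvature is [ab_d (ab_proj w)] ([ab_proj_curvature]), a coboundary. *)

Lemma cohomology_class_eq0 (K : fieldType) (C : complex K) (x y : C)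
    (dx0 : cx_d C x = 0) : x = cx_d C y -> cohomology_class dx0 = 0.
Proof.
move=> xE; rewrite -[RHS](linear0 (quot_proj (@coboundary_pred K C))).
by apply/quot_projP; rewrite subr0; apply/asboolP; exists y.
Qed.

Lemma ab_proj_derived (K : fieldType) (n : nat) (L : curvedLn K n) (x : L) :
  x \in @derived_pred K n L -> ab_proj x = 0.
Proof.
move=> x'; rewrite -[RHS](linear0 (@ab_proj K n L)).
by apply/quot_projP; rewrite subr0.
Qed.

Lemma ab_proj_curvature (K : fieldType) (n : nat) (L : curvedLn K n) (w : L) :
  maurer_cartan w -> ab_proj (ell [::] : L) = ab_d (ab_proj w).
Proof.
case=> _ mc; rewrite ab_dE; apply/eqP; rewrite -subr_eq0 -linearB; apply/eqP.
apply: ab_proj_derived.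
case: n L w mc => [|n] L w; rewrite big_ord_recl /= /varsigma fact0 invr1 mulr1
    expr0 scaleN1r.
  (* For n = 0 the sum has no l_1 term, but then l_1 = 0 anyway. *)
  move=> /eqP; rewrite big_ord0 addr0 oppr_eq0 => /eqP ->.
  by rewrite sub0r rpredN /ell1 ell_vanish ?rpred0.
(* Since [varsigma] is -1 at 0 and 1 at 1, the two leading terms are [- ell [::]] and [ell1 w]. *)
rewrite big_ord_recl /= /bump /= factS fact0 muln1 invr1 mulr1 expr1 opprK scale1r.
rewrite addrA => /eqP; rewrite addr_eq0 => /eqP mc.
(* Up to sign, the difference is the tail of the sum, whose brackets take [k + 2] arguments. *)
rewrite -opprB rpredN addrC mc rpredN; apply: rpred_sum => k _.
by apply/rpredZ/ell_derived.
Qed.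

Theorem propositionA8 (K : fieldType) (charK : [pchar K] =i pred0)
    (n : nat) (L : curvedLn K n) :
  (exists w : L, maurer_cartan w) -> curvature_class L = 0.
Proof.
by case=> w /ab_proj_curvature e; apply: (cohomology_class_eq0 K (ab_complex L) _ _ _ e).
Qed.
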